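(* With high probability, $Q^n(1)$ does not contain a connected component spanning $\Omega(2^n)$ vertices. That is, for every fixed $\varepsilon>0$, the probability that $Q^n(1)$ has a connected component with at least $\varepsilon 2^n$ vertices tends to $0$ as $n\to\infty$.
   Context: $Q^n$ is the $n$-dimensional cube: the graph with vertex set $V=\{0,1\}^n$ in which two vertices are adjacent iff they differ in precisely one coordinate. For an integer $1\le k\le n-1$, $Q^n(k)$ (the $k$-out model) is the random (simple, undirected) spanning subgraph of $Q^n$ with vertex set $V$ obtained as follows: independently for every $v\in V$, choose a set of $k$ distinct edges uniformly from all the $\binom{n}{k}$ sets of $k$ distinct edges of $Q^n$ incident to $v$; the edge set of $Q^n(k)$ is the union of all chosen sets. A sequence of events holds with high probability (w.h.p.) if its probability tends to $1$ as $n\to\infty$. *)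

(* Defs.v *)
From mathcomp Require Import all_boot all_order all_algebra.

Set Implicit Arguments.
Unset Strict Implicit.
Unset Printing Implicit Defensive.

Import Order.TTheory GRing.Theory Num.Theory.
Local Open Scope ring_scope.

Definition vertex (n : nat) : finType := {ffun 'I_n -> bool}.

Definition cube_adj (n : nat) (u v : vertex n) : bool :=
  #|[set i | u i != v i]| == 1%N.

(* An edge is the two-element set of its end points, and a spanning subgraph
   of the cube is given by its set of edges. *)
Definition edge_set (n : nat) : finType := {set {set vertex n}}.

Definition incident_edges (n : nat) (v : vertex n) : edge_set n :=
  [set [set v; w] | w in [set w | cube_adj v w]].

Definition kout_choices (n k : nat) (v : vertex n) : {set edge_set n} :=
  [set S : edge_set n | (S \subset incident_edges v) && (#|S| == k)].

Definition uniform_weight (R : numFieldType) (T : finType) (A : {set T})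
    (x : T) : R :=
  if x \in A then #|A|%:R^-1 else 0.

Definition kout_graph (n : nat) (c : {ffun vertex n -> edge_set n}) :
    edge_set n :=
  \bigcup_v c v.

(* The choices c v are independent, so the law of c is the product of the
   uniform laws on kout_choices k v. *)
Definition kout_weight (R : numFieldType) (n k : nat)
    (c : {ffun vertex n -> edge_set n}) : R :=
  \prod_v uniform_weight R (kout_choices k v) (c v).

Definition kout_prob (R : numFieldType) (n k : nat) (P : pred (edge_set n)) :
    R :=
  \sum_(c | P (kout_graph c)) kout_weight R k c.

(* Irreflexive on graphs whose edges have two elements, as [set u; u] is a
   singleton. *)
Definition graph_adj (n : nat) (E : edge_set n) : rel (vertex n) :=
  fun u v => [set u; v] \in E.

Definition components (n : nat) (E : edge_set n) : {set {set vertex n}} :=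
  [set [set v | connect (graph_adj E) u v] | u in vertex n].

Definition has_component_ge (R : numFieldType) (n : nat) (t : R) :
    pred (edge_set n) :=
  fun E => [exists C in components E, t <= #|C|%:R].

Lemma card_incident_edges (n : nat) (v : vertex n) :
  #|incident_edges v| = n.
Proof.
pose flip i : vertex n := [ffun j => (i == j) (+) v j].
have flip_inj : injective flip.
  move=> i j /ffunP /(_ i); rewrite !ffunE eqxx.
  by case: eqP => // _; case: (v i).
have nbrsE : [set w | cube_adj v w] = [set w in codom flip].
  apply/setP => w; rewrite !inE; apply/idP/codomP => [/cards1P[i Di]|[i ->]].
    exists i; apply/ffunP => j.
    have := in_set1 j i; rewrite -Di inE ffunE (eq_sym i) => <-.
    by case: (v j); case: (w j).
  apply/cards1P; exists i; apply/setP => j.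
  by rewrite !inE ffunE (eq_sym j); case: (i == j); case: (v j).
rewrite /incident_edges nbrsE card_in_imset => [|w w'].
  by rewrite cardsE card_codom ?card_ord.
rewrite !inE => /codomP[i Dw] /codomP[j Dw'] /setP eqw.
have neq k : (flip k == v) = false.
  by apply/eqP => /ffunP /(_ k); rewrite ffunE eqxx; case: (v k).
have := eqw w; rewrite !inE eqxx orbT Dw neq /= => /esym /eqP e.
by rewrite e Dw'.
Qed.

Lemma card_kout_choices (n k : nat) (v : vertex n) :
  #|kout_choices k v| = 'C(n, k).
Proof. by rewrite cards_draws card_incident_edges. Qed.

Lemma kout_prob_total (R : numFieldType) (n k : nat) :
  (k <= n)%N -> kout_prob R k (fun _ : edge_set n => true) = 1.
Proof.
move=> le_kn; rewrite /kout_prob /kout_weight.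
rewrite -(bigA_distr_bigA (fun v => uniform_weight R (kout_choices k v))).
apply: big1 => v _; rewrite /uniform_weight -big_mkcond sumr_const.
rewrite card_kout_choices -[LHS]mulr_natl mulfV //.
by rewrite pnatr_eq0 -lt0n bin_gt0.
Qed.

(* Main.v *)
Require Import Defs.
From mathcomp Require Import all_boot all_order all_algebra.
From mathcomp Require Import ring zify.

(** Let f v be the neighbour chosen by v.  Two vertices are in the same component iff their
    f-orbits meet.  An orbit with more than m + 1 vertices contains a non-backtracking
    self-avoiding walk with m + 1 prescribed choices, and there are at most
    N n (n-1)^m of these (N = 2^n), so the expected number of vertices with a long orbit is
    at most N (1 - 1/n)^m.  If short orbits of u and v first meet at a after s and t steps,
    reading backwards from a gives one of at most N n^s n^t pairs of walks, each present with
    probability at most n^-(s+t): the expected number of such pairs (u, v) is at most N.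
    With m = n^2 the expected number of connected pairs is thus o(N^2), whereas a component
    with eps N vertices contributes (eps N)^2. *)

Set Implicit Arguments.
Unset Strict Implicit.
Unset Printing Implicit Defensive.

Import Order.TTheory GRing.Theory Num.Theory.

(** * Walks of bounded degree, and orbits read backwards *)

Lemma card_path_tuple (T : finType) (r : rel T) (D : nat) (x : T) (s : nat) :
  (forall y, #|[set z | r y z]| <= D) ->
  #|[set p : s.-tuple T | path r x p]| <= D ^ s.
Proof.
move=> rD; elim: s x => [|s IHs] x.
  by rewrite (leq_trans (max_card _)) // card_tuple expn0.
pose F (yp : T * s.-tuple T) := [tuple of yp.1 :: yp.2].
have sub : [set p : s.+1.-tuple T | path r x p] \subset
    F @: [set yp : T * s.-tuple T | r x yp.1 && path r yp.1 yp.2].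
  apply/subsetP => p; case/tupleP: p => y p; rewrite inE /= => xyp.
  by apply/imsetP; exists (y, p); rewrite ?inE.
apply: leq_trans (subset_leq_card sub) _.
apply: leq_trans (leq_imset_card _ _) _.
rewrite -sum1dep_card -(pair_big_dep (r x) (fun y p => path r y (tval p)) (fun _ _ => 1)) /=.
apply: leq_trans (_ : \sum_(y | r x y) D ^ s <= _).
  by apply: leq_sum => y _; rewrite sum1dep_card.
by rewrite sum_nat_const expnS leq_mul2r -(cardsE (r x)) rD orbT.
Qed.

(** Each pair puts a vertex of the walk before its predecessor: along a backward walk the pairs are
    then (chooser, chosen), and the choosers are exactly the entries of [p]. *)
Lemma path_all_zip (T : Type) (e : rel T) (x : T) (p : seq T) :
  path e x p = all (fun z => e z.2 z.1) (zip p (belast x p)).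
Proof. by elim: p x => //= y p IHp x; rewrite IHp. Qed.

Lemma path_rev_traject (T : eqType) (f : T -> T) (x : T) (s : nat) :
  path (fun u v => f v == u) (iter s f x) (rev (traject f x s)).
Proof.
have := rev_path (fun u v => f v == u) x (traject f (f x) s).
rewrite fpath_traject last_traject.
suff -> : belast x (traject f (f x) s) = traject f x s by [].
by have := trajectSr f x s; rewrite trajectS lastI => /rcons_inj[].
Qed.

(** * Meeting orbits of a self-map *)

Section Dynamics.
Variables (T : finType) (f : T -> T).

Lemma traject_uniq_order (x : T) (s : nat) : s <= order f x -> uniq (traject f x s).
Proof.
by move=> le_s; rewrite -(take_traject f x le_s) take_uniq // -/(orbit f x) orbit_uniq.
Qed.

(** Take [s'] to be the first time the orbit of [x] enters the orbit of [y], and [t'] the first time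
    the orbit of [y] reaches that point. Before time [s'] the orbit of [x] avoids all of
    [orbit f y], so the two initial segments are disjoint. *)
Lemma meet_disjoint (x y : T) (s t : nat) : iter s f x = iter t f y ->
  exists s' t', [/\ s' < order f x, t' < order f y, iter s' f x = iter t' f y &
    uniq (traject f x s' ++ traject f y t')].
Proof.
move=> st; pose a := mem (orbit f y).
have has_a : has a (orbit f x).
  apply/hasP; exists (iter s f x); first by rewrite -fconnect_orbit fconnect_iter.
  by rewrite /= -fconnect_orbit st fconnect_iter.
have lt_s := has_a; rewrite has_find size_orbit in lt_s.
set s' := find a _ in lt_s.
have a_s : iter s' f x \in orbit f y.
  by have := nth_find x has_a; rewrite /orbit nth_traject.
rewrite -fconnect_orbit in a_s.
exists s', (findex f y (iter s' f x)); split=> //.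
- exact: findex_max.
- by rewrite iter_findex.
rewrite cat_uniq !traject_uniq_order ?(ltnW lt_s) ?(ltnW (findex_max a_s)) // andbT /=.
apply/hasPn => z z_y; apply/negP => /trajectP[i lt_i z_x].
have := before_find x lt_i; rewrite /orbit nth_traject ?(ltn_trans lt_i) // -z_x.
case/trajectP: z_y => j _ -> /negbT/negP; apply.
by rewrite /= -fconnect_orbit fconnect_iter.
Qed.

Lemma connect_iter (e : rel T) (x y : T) :
  (forall u v, e u v -> f u = v \/ f v = u) -> connect e x y ->
  exists s t, iter s f x = iter t f y.
Proof.
move=> ef /connectP[p]; elim: p x => [|z p IHp] x /=; first by move=> _ ->; exists 0, 0.
case/andP=> /ef xz /IHp{}IHp /IHp[s [t st]]; case: xz => [fx|fz].
  by exists s.+1, t; rewrite iterSr fx.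
(* The edge is traversed against [f]: one more application of [f] to both iterates moves the start
   from [z] to [x]. *)
by exists s, t.+1; rewrite -fz -iterSr iterS st.
Qed.

End Dynamics.

(** * The chosen neighbour as a self-map of the cube *)

Definition chosen (n : nat) (c : {ffun vertex n -> edge_set n}) (v w : vertex n) : bool :=
  c v == [set [set v; w]].

Definition legal (n : nat) (c : {ffun vertex n -> edge_set n}) : Prop :=
  forall v, c v \in kout_choices 1 v.

(** [odflt v] makes this a self-map for every [c]; for legal [c] the [pick] always succeeds, with
    the unique chosen neighbour. *)
Definition target (n : nat) (c : {ffun vertex n -> edge_set n}) (v : vertex n) : vertex n :=
  odflt v [pick w | chosen c v w].

Lemma card_cube_adj (n : nat) (v : vertex n) : #|[set w | cube_adj v w]| = n.
Proof.
rewrite -[RHS](card_incident_edges v) card_in_imset // => w w'.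
rewrite !inE => vw vw' /setP eqw.
have neq u : cube_adj v u -> u != v.
  by apply: contraTneq => ->; apply/cards1P => -[i /setP/(_ i)]; rewrite !inE !eqxx.
by have := eqw w; rewrite !inE eqxx orbT (negPf (neq w vw)) => /esym/eqP.
Qed.

Lemma cube_adjC (n : nat) : symmetric (@cube_adj n).
Proof.
by move=> v w; rewrite /cube_adj; congr (#|pred_of_set _| == _); apply/setP => i; rewrite !inE eq_sym.
Qed.

Lemma legal_target (n : nat) (c : {ffun vertex n -> edge_set n}) (v : vertex n) :
  legal c -> cube_adj v (target c v) /\ chosen c v (target c v).
Proof.
move=> /(_ v); rewrite inE => /andP[sub /cards1P[e Dc]].
have : e \in incident_edges v by apply: (subsetP sub); rewrite Dc set11.
case/imsetP => w; rewrite inE => vw De.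
have eq_w u : chosen c v u -> u = w.
  rewrite /chosen Dc De => /eqP/set1_inj/setP eqv.
  have := eqv u; have := eqv w; rewrite !inE !eqxx !orbT.
  by case: eqP => [->|_] /=; case: eqP.
rewrite /target; case: pickP => [u cu|/(_ w)] /=; last by rewrite /chosen Dc De eqxx.
by rewrite {1}(eq_w u cu).
Qed.

Lemma kout_graph_target (n : nat) (c : {ffun vertex n -> edge_set n}) (u v : vertex n) :
  legal c -> graph_adj (kout_graph c) u v -> target c u = v \/ target c v = u.
Proof.
move=> cL /bigcupP[x _]; have [_ /eqP->] := legal_target x cL.
rewrite inE => /eqP/setP; set y := target c x => eqx.
have := eqx y; have := eqx x; have := eqx v; have := eqx u.
(* In the first and last of the four cases [u = v]; equality of the two sets then forces
   [target c x = x], and the claim persists. *)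
rewrite !inE !eqxx !orbT /= => /esym/orP[]/eqP-> /esym/orP[]/eqP->.
- by rewrite !orbb => _ /eqP; left.
- by left.
- by right.
- by rewrite !orbb => /eqP exy _; left; rewrite -{1}exy.
Qed.

Local Open Scope ring_scope.

(** * Expectation under the 1-out law *)

Section Expectation.
Variables (R : realFieldType) (n : nat).
Implicit Types c : {ffun vertex n -> edge_set n}.

Lemma uniform_weight_ge0 (T : finType) (A : {set T}) (x : T) :
  0 <= uniform_weight R A x.
Proof. by rewrite /uniform_weight; case: ifP => // _; rewrite invr_ge0. Qed.

Lemma sum_uniform_weight_le1 (T : finType) (A : {set T}) (P : pred T) :
  \sum_(x | P x) uniform_weight R A x <= 1.
Proof.
apply: (@le_trans _ _ (\sum_x uniform_weight R A x)).
  rewrite [leRHS](bigID P) /= lerDl; apply: sumr_ge0 => x _; exact: uniform_weight_ge0.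
rewrite /uniform_weight -big_mkcond sumr_const -[leLHS]mulr_natl.
have [->|A0] := eqVneq #|A| 0%N; first by rewrite mul0r.
by rewrite mulfV // pnatr_eq0.
Qed.

Lemma kout_weight_ge0 (k : nat) c : 0 <= kout_weight R k c.
Proof. by apply: prodr_ge0 => v _; apply: uniform_weight_ge0. Qed.

Lemma kout_weight1_legal c : kout_weight R 1 c != 0 -> legal c.
Proof.
move=> /prodf_neq0 nz v; apply: contraR (nz v isT) => cv.
by rewrite /uniform_weight (negPf cv) eqxx.
Qed.

Definition kout_ex (X : {ffun vertex n -> edge_set n} -> R) : R :=
  \sum_c kout_weight R 1 c * X c.

(** Illegal [c] have weight 0, so comparing on legal [c] is enough; there [target c] follows cube
    edges. *)
Lemma kout_ex_le X Y : (forall c, legal c -> X c <= Y c) -> kout_ex X <= kout_ex Y.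
Proof.
move=> XY; apply: ler_sum => c _.
have [->|/kout_weight1_legal cL] := eqVneq (kout_weight R 1 c) 0; first by rewrite !mul0r.
by rewrite ler_wpM2l ?kout_weight_ge0 ?XY.
Qed.

Lemma kout_exD X Y : kout_ex (fun c => X c + Y c) = kout_ex X + kout_ex Y.
Proof. by rewrite -big_split; apply: eq_bigr => c _; rewrite mulrDr. Qed.

Lemma kout_ex_sum (I : finType) (P : pred I) X :
  kout_ex (fun c => \sum_(i | P i) X i c) = \sum_(i | P i) kout_ex (X i).
Proof.
rewrite /kout_ex exchange_big; apply: eq_bigr => c _; exact: mulr_sumr.
Qed.

Lemma kout_exZ a X : kout_ex (fun c => a * X c) = a * kout_ex X.
Proof. by rewrite /kout_ex mulr_sumr; apply: eq_bigr => c _; rewrite mulrCA. Qed.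

Lemma kout_probE (P : pred (edge_set n)) :
  kout_prob R 1 P = kout_ex (fun c => (P (kout_graph c))%:R).
Proof.
rewrite /kout_prob /kout_ex big_mkcond; apply: eq_bigr => c _.
by case: (P _); rewrite ?mulr1 ?mulr0.
Qed.

(* Independence at distinct vertices; only an upper bound, as l need not follow cube edges. *)
Lemma kout_ex_all_chosen (l : seq (vertex n * vertex n)) :
  uniq (unzip1 l) ->
  kout_ex (fun c => (all (fun z => chosen c z.1 z.2) l)%:R) <= n%:R ^- size l.
Proof.
move=> Ul.
(* [Q v] gathers the constraints that [l] puts on the choice at [v] alone, so the event is a product
   event and its probability factors over the vertices. *)
pose Q v S := all (fun z : vertex n * vertex n => (z.1 == v) ==> (S == [set [set z.1; z.2]])) l.
have -> : kout_ex (fun c => (all (fun z => chosen c z.1 z.2) l)%:R)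
  = \prod_v \sum_(S | Q v S) uniform_weight R (kout_choices 1 v) S.
  rewrite bigA_distr_big_dep /kout_ex [RHS]big_mkcond; apply: eq_bigr => c _.
  suff -> : all (fun z => chosen c z.1 z.2) l = (c \in family Q).
    by case: (_ \in _); rewrite ?mulr1 ?mulr0.
  apply/allP/familyP => [cl v|cQ z zl].
    by apply/allP => z /cl cz; apply/implyP => /eqP <-.
  by have /allP/(_ _ zl) := cQ z.1; rewrite eqxx.
(* A factor [1/n] for each vertex that occurs as a chooser, and 1 elsewhere; as the choosers are
   distinct, there are [size l] of them. *)
have -> : n%:R ^- size l = \prod_v (if v \in unzip1 l then n%:R^-1 else 1) :> R.
  rewrite -big_mkcond prodr_const /= exprVn; congr (_ ^- _).
  by rewrite (card_uniqP Ul) size_map.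
apply: ler_prod => v _; apply/andP; split.
  by apply: sumr_ge0 => S _; apply: uniform_weight_ge0.
case: ifP => [/mapP[z zl ->]|_]; last exact: sum_uniform_weight_le1.
apply: (@le_trans _ _ (\sum_(S | S == [set [set z.1; z.2]]) uniform_weight R (kout_choices 1 z.1) S)).
  rewrite big_mkcond [leRHS]big_mkcond; apply: ler_sum => S _.
  case: ifP => [/allP/(_ _ zl)|_]; first by rewrite eqxx => /= ->.
  by case: ifP => // _; apply: uniform_weight_ge0.
rewrite big_pred1_eq /uniform_weight card_kout_choices bin1.
by case: ifP => // _; rewrite invr_ge0.
Qed.

End Expectation.

(** * First moments of meeting pairs and of long orbits *)

Section FirstMoment.
Variables (R : realFieldType) (n : nat).
Implicit Types c : {ffun vertex n -> edge_set n}.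

(** Both trajectories stop one step before the common point, so the event prescribes the choices of
    exactly [s + t] distinct vertices. *)
Definition first_meet (T : finType) (f : T -> T) (s t : nat) (x y : T) : bool :=
  (iter s f x == iter t f y) && uniq (traject f x s ++ traject f y t).

Definition back_step c : rel (vertex n) :=
  fun u v => cube_adj u v && chosen c v u.

(** Rooting both walks at the meeting point costs a single factor [2^n]; the starting points [x] and
    [y] reappear as the ends of the walks. *)
Definition back_walks c (s t : nat) : {set vertex n * (s.-tuple (vertex n) * t.-tuple (vertex n))} :=
  [set apq : vertex n * (s.-tuple (vertex n) * t.-tuple (vertex n)) |
    [&& path (back_step c) apq.1 apq.2.1, path (back_step c) apq.1 apq.2.2
      & uniq (apq.2.1 ++ apq.2.2)]].

(** Reversing the two trajectories of a meeting pair gives a back walk, from which [ends] recovers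
    the pair, also when a walk is empty. *)
Lemma card_meet_le c (s t : nat) : legal c ->
  (#|[set xy | first_meet (target c) s t xy.1 xy.2]| <= #|back_walks c s t|)%N.
Proof.
move=> cL; set f := target c.
have back x i : path (back_step c) (iter i f x) (rev (traject f x i)).
  have := path_rev_traject f x i; apply: sub_path => u v /= /eqP <-.
  by rewrite /back_step cube_adjC; apply/andP; exact: legal_target.
have last_rev x i a : iter i f x = a -> last a (rev (traject f x i)) = x.
  by case: i => [|i] //= _; rewrite rev_cons last_rcons.
pose ends (apq : vertex n * (s.-tuple (vertex n) * t.-tuple (vertex n))) :=
  (last apq.1 apq.2.1, last apq.1 apq.2.2).
apply: leq_trans (leq_imset_card ends _); apply: subset_leq_card.
apply/subsetP => -[x y]; rewrite inE /first_meet /= -/f => /andP[/eqP xy Uxy].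
have sz z i : size (rev (traject f z i)) == i by rewrite size_rev size_traject.
apply/imsetP; exists (iter s f x, (Tuple (sz x s), Tuple (sz y t))).
  rewrite inE /= back {1}xy back /=.
  move: Uxy; rewrite !cat_uniq !rev_uniq has_rev.
  by under [X in _ -> [&& _, ~~ X & _]]eq_has => z do rewrite /= mem_rev.
by rewrite /ends /= !last_rev.
Qed.

(** Linearity of expectation over the deterministic set [A]: membership of [i] in [Z c] forces the
    [k] choices listed in [l i], at distinct vertices, hence has probability at most [n^-k]. *)
Lemma kout_ex_card_le (I : finType) (Z : {ffun vertex n -> edge_set n} -> {set I})
    (A : {set I}) (l : I -> seq (vertex n * vertex n)) (k M : nat) :
  (forall c i, i \in Z c -> [&& i \in A, uniq (unzip1 (l i))
    & all (fun z => chosen c z.1 z.2) (l i)]) ->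
  (forall i, size (l i) = k) -> (#|A| <= M)%N ->
  kout_ex (fun c => #|Z c|%:R) <= M%:R / n%:R ^+ k :> R.
Proof.
move=> Zl szl AM.
apply: (@le_trans _ _ (\sum_(i in A | uniq (unzip1 (l i)))
    kout_ex (fun c => (all (fun z => chosen c z.1 z.2) (l i))%:R))).
  rewrite -kout_ex_sum; apply: kout_ex_le => c _.
  rewrite -sum1_card natr_sum big_mkcond [leRHS]big_mkcond; apply: ler_sum => i _.
  case: ifP => [/Zl/and3P[-> -> ->] //|_].
  by case: ifP => // _; case: all.
apply: (@le_trans _ _ (\sum_(i in A) n%:R ^- k)).
  rewrite big_mkcondr; apply: ler_sum => i _; case: ifP => [Ui|_].
    by rewrite -(szl i); apply: kout_ex_all_chosen.
  by rewrite invr_ge0 exprn_ge0.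
rewrite sumr_const -[leLHS]mulr_natl; apply: ler_wpM2r; last by rewrite ler_nat.
by rewrite invr_ge0 exprn_ge0.
Qed.

Lemma card_vertex : #|vertex n| = (2 ^ n)%N.
Proof. by rewrite card_ffun card_bool card_ord. Qed.

Lemma kout_ex_meet (s t : nat) : (0 < n)%N ->
  kout_ex (fun c => #|[set xy | first_meet (target c) s t xy.1 xy.2]|%:R) <= 2 ^+ n :> R.
Proof.
move=> n0.
pose adj2 := [set apq : vertex n * (s.-tuple (vertex n) * t.-tuple (vertex n)) |
  path (@cube_adj n) apq.1 apq.2.1 && path (@cube_adj n) apq.1 apq.2.2].
pose steps (a : vertex n) p := zip p (belast a p).
have szsteps i a (p : i.-tuple (vertex n)) : size (steps a p) = i.
  by rewrite size_zip size_belast size_tuple minnn.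
have steps1 i a (p : i.-tuple (vertex n)) : unzip1 (steps a p) = p.
  by rewrite unzip1_zip // size_belast.
apply: (@le_trans _ _ (kout_ex (fun c => #|back_walks c s t|%:R))).
  by apply: kout_ex_le => c cL; rewrite ler_nat card_meet_le.
have bound : (#|adj2| <= 2 ^ n * (n ^ s * n ^ t))%N.
  rewrite -sum1dep_card.
  rewrite -(pair_big_dep xpredT (fun a (pq : s.-tuple (vertex n) * t.-tuple (vertex n)) =>
     path (@cube_adj n) a pq.1 && path (@cube_adj n) a pq.2) (fun _ _ => 1%N)) /=.
  rewrite -card_vertex -sum_nat_const; apply: leq_sum => a _.
  rewrite sum1dep_card.
  apply: leq_trans (_ : #|setX [set p : s.-tuple _ | path (@cube_adj n) a p]
      [set p : t.-tuple _ | path (@cube_adj n) a p]| <= _)%N.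
    by apply/subset_leq_card/subsetP => pq; rewrite !inE.
  by rewrite cardsX leq_mul // card_path_tuple // => v; rewrite card_cube_adj.
apply: (@le_trans _ _ ((2 ^ n * (n ^ s * n ^ t))%N%:R / n%:R ^+ (s + t))).
  pose l (apq : vertex n * (s.-tuple (vertex n) * t.-tuple (vertex n))) :=
    steps apq.1 apq.2.1 ++ steps apq.1 apq.2.2.
  apply: (kout_ex_card_le (l := l)) bound.
- move=> c [a [p q]]; rewrite !inE /= => /and3P[ap aq Upq].
  have sub x i (r : i.-tuple (vertex n)) : path (back_step c) x r ->
      path (@cube_adj n) x r && all (fun z => chosen c z.1 z.2) (steps x r).
    move=> xr; apply/andP; split; first by apply: sub_path xr => u v /andP[].
    rewrite -(path_all_zip (fun u v => chosen c v u)).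
    by apply: sub_path xr => u v /andP[].
  have /andP[-> cp] := sub _ _ _ ap; have /andP[-> cq] := sub _ _ _ aq.
  by rewrite all_cat cp cq /unzip1 map_cat -/(unzip1 _) -/(unzip1 _) !steps1 Upq.
- by case=> a [p q]; rewrite size_cat !szsteps.
by rewrite -expnD natrM !natrX mulfK // expf_neq0 // pnatr_eq0 -lt0n.
Qed.

(* The condition on e makes the out-degree at most n - 1 at every pair, edge or not. *)
Definition nonbacktracking : rel (vertex n * vertex n) :=
  fun e g => [&& cube_adj e.1 e.2, g.1 == e.2, cube_adj g.1 g.2 & g.2 != e.1].

Lemma card_nonbacktracking e : (#|[set g | nonbacktracking e g]| <= n.-1)%N.
Proof.
case e12: (cube_adj e.1 e.2); last first.
  by rewrite (eq_card0 (A := [set g | nonbacktracking e g])) // => g; rewrite inE /nonbacktracking e12.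
apply: leq_trans (_ : #|[set w | cube_adj e.2 w] :\ e.1| <= _)%N; last first.
  have := cardsD1 e.1 [set w | cube_adj e.2 w].
  by rewrite card_cube_adj inE cube_adjC e12 add1n => /(congr1 predn) /= ->.
apply: leq_trans (leq_imset_card (pair e.2) _); apply: subset_leq_card.
apply/subsetP => -[v w]; rewrite inE => /and4P[_ /= /eqP-> vw we].
by apply/imsetP; exists w; rewrite // !inE we.
Qed.

(** The walk is coded by its arcs because the ban on backtracking involves two consecutive ones. The
    first arc has [n] options once its tail is fixed, each of the [m] others at most [n - 1]. *)
Definition long_walks c (m : nat) : {set (vertex n * vertex n) * m.-tuple (vertex n * vertex n)} :=
  [set ez : (vertex n * vertex n) * m.-tuple (vertex n * vertex n) |
    [&& cube_adj ez.1.1 ez.1.2, path nonbacktracking ez.1 ez.2,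
      uniq (unzip1 (ez.1 :: ez.2)) & all (fun z => chosen c z.1 z.2) (ez.1 :: ez.2)]].

(** The [m + 1] arcs span [m + 2] orbit points, all distinct by the bound on the order. The head of
    the last arc must be included: not backtracking means that the iterates [i] and [i + 2] differ
    for all [i < m]. *)
Lemma card_long_orbit_le c (m : nat) : legal c ->
  (#|[set x | m.+1 < order (target c) x]| <= #|long_walks c m|)%N.
Proof.
move=> cL; set f := target c.
apply: leq_trans (leq_imset_card (fun ez => ez.1.1) _); apply: subset_leq_card.
apply/subsetP => x; rewrite inE => lt_m.
pose arc v := (v, f v).
have sz : size [seq arc v | v <- traject f (f x) m] == m by rewrite size_map size_traject.
apply/imsetP; exists (arc x, Tuple sz) => //.
have Ux : uniq (traject f x m.+2) by apply: traject_uniq_order.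
have arcs : arc x :: [seq arc v | v <- traject f (f x) m] = [seq arc v | v <- traject f x m.+1] by [].
rewrite inE [tval _]/= arcs (legal_target x cL).1 /=.
apply/and3P; split.
- rewrite path_map; apply/(pathP x) => i; rewrite size_traject => lt_i.
  have -> : nth x (x :: traject f (f x) m) i = iter i f x.
    by rewrite -[x :: _]/(traject f x m.+1) nth_traject // ltnW.
  rewrite (set_nth_default (f x)) ?size_traject // nth_traject //.
  rewrite /nonbacktracking /= -iterSr iterS eqxx !(legal_target _ cL).1 /=.
  have lt_i2 : (i < m.+2)%N by rewrite ltnS ltnW // ltnS ltnW.
  have := nth_uniq x (s := traject f x m.+2) (i := i.+2) (j := i).
  rewrite size_traject (nth_traject _ lt_i2) (@nth_traject _ _ i.+2 m.+2) // => -> //.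
  by rewrite gtn_eqF.
- rewrite -[_ && _]/(uniq (unzip1 (arc x :: _))) arcs /unzip1 -map_comp map_id.
  by apply: traject_uniq_order; apply: ltnW.
- rewrite -[_ && _]/(all _ (arc x :: _)) arcs all_map; apply/allP => v _.
  exact: (legal_target v cL).2.
Qed.

Lemma kout_ex_long_orbit (m : nat) : (0 < n)%N ->
  kout_ex (fun c => #|[set x | (m.+1 < order (target c) x)%N]|%:R)
    <= 2 ^+ n * (n.-1%:R / n%:R) ^+ m :> R.
Proof.
move=> n0.
pose A := [set ez : (vertex n * vertex n) * m.-tuple (vertex n * vertex n) |
  cube_adj ez.1.1 ez.1.2 && path nonbacktracking ez.1 ez.2].
apply: (@le_trans _ _ (kout_ex (fun c => #|long_walks c m|%:R))).
  by apply: kout_ex_le => c cL; rewrite ler_nat card_long_orbit_le.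
have bound : (#|A| <= 2 ^ n * n * n.-1 ^ m)%N.
  rewrite -sum1dep_card.
  rewrite -(pair_big_dep (fun e : vertex n * vertex n => cube_adj e.1 e.2)
     (fun e (z : m.-tuple (vertex n * vertex n)) => path nonbacktracking e z) (fun _ _ => 1%N)) /=.
  apply: leq_trans (_ : \sum_(e : vertex n * vertex n | cube_adj e.1 e.2) n.-1 ^ m <= _)%N.
    by apply: leq_sum => e _; rewrite sum1dep_card; apply: card_path_tuple; exact: card_nonbacktracking.
  rewrite sum_nat_const leq_mul2r; apply/orP; right.
  rewrite -sum1_card -(pair_big_dep xpredT (fun u v => cube_adj u v) (fun _ _ => 1%N)) /=.
  rewrite -card_vertex -sum_nat_const; apply: leq_sum => u _.
  by rewrite sum1dep_card card_cube_adj.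
apply: (@le_trans _ _ ((2 ^ n * n * n.-1 ^ m)%N%:R / n%:R ^+ m.+1)).
  pose l (ez : (vertex n * vertex n) * m.-tuple (vertex n * vertex n)) := ez.1 :: ez.2.
  apply: (kout_ex_card_le (l := l)) bound.
- by move=> c [e z]; rewrite !inE => /and4P[-> -> -> ->].
- by case=> e z; rewrite /= size_tuple.
have nR0 : n%:R != 0 :> R by rewrite pnatr_eq0 -lt0n.
rewrite !natrM !natrX exprMn exprVn exprS le_eqVlt; apply/orP; left; apply/eqP.
have := expf_neq0 m nR0; move: (n%:R ^+ m) => d d0.
by field; rewrite d0 nR0.
Qed.

(** * From orbits to the size of a component *)

(** If neither orbit has more than [L] points, the times given by [meet_disjoint] are below [L], and
    their summand equals 1. *)
Lemma iter_meet_bound (T : finType) (f : T -> T) (L : nat) (x y : T) (s t : nat) :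
  iter s f x = iter t f y ->
  (1 <= (L < order f x) + (L < order f y) + \sum_(i < L) \sum_(j < L) first_meet f i j x y)%N.
Proof.
move=> /meet_disjoint[i [j [lt_i lt_j ij U]]].
case: (ltnP L (order f x)) => // le_x; case: (ltnP L (order f y)) => // le_y.
rewrite !add0n (bigD1 (Ordinal (leq_trans lt_i le_x))) //=.
rewrite (bigD1 (Ordinal (leq_trans lt_j le_y))) //=.
by rewrite {1}/first_meet ij eqxx U.
Qed.

(** Orbits of any two vertices of [K] meet, so [iter_meet_bound] can be summed over [K * K];
    extending the right-hand side to all pairs of vertices only adds nonnegative terms. *)
Lemma card_component_sq_le c (L : nat) (K : {set vertex n}) : legal c ->
  K \in components (kout_graph c) ->
  (#|K| ^ 2 <= #|vertex n| * #|[set x | L < order (target c) x]| +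
     #|vertex n| * #|[set x | L < order (target c) x]| +
     \sum_(i < L) \sum_(j < L) #|[set xy | first_meet (target c) i j xy.1 xy.2]|)%N.
Proof.
move=> cL /imsetP[u _ ->]; set K' := [set v | _]; set f := target c.
have gsym : connect_sym (graph_adj (kout_graph c)).
  by apply: sym_connect_sym => v w; rewrite /graph_adj setUC.
have KK x y : x \in K' -> y \in K' -> exists s t, iter s f x = iter t f y.
  rewrite !inE gsym => ux uy.
  by apply: connect_iter (connect_trans ux uy) => v w; apply: kout_graph_target.
pose g x y := ((L < order f x) + (L < order f y) + \sum_(i < L) \sum_(j < L) first_meet f i j x y)%N.
apply: (@leq_trans (\sum_x \sum_y g x y)).
  rewrite -mulnn -sum_nat_const big_mkcond; apply: leq_sum => x _.
  case: ifP => // xK; rewrite -sum1_card big_mkcond; apply: leq_sum => y _.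
  case: ifP => // yK; have [s [t st]] := KK x y xK yK; exact: iter_meet_bound st.
rewrite /g; under eq_bigr => x _ do rewrite !big_split /=.
rewrite !big_split /=; apply: eq_leq; congr (_ + _ + _)%N.
- under eq_bigr => x _ do rewrite sum_nat_const.
  by rewrite -big_distrr -sum1dep_card [in RHS]big_mkcond /=; congr (_ * _)%N;
    apply: eq_bigr => x _; case: ltnP.
- rewrite sum_nat_const; congr (_ * _)%N.
  by rewrite -sum1dep_card [in RHS]big_mkcond /=; apply: eq_bigr => x _; case: ltnP.
- rewrite pair_big /= exchange_big; apply: eq_bigr => i _.
  rewrite exchange_big; apply: eq_bigr => j _.
  by rewrite -sum1dep_card [in RHS]big_mkcond /=; apply: eq_bigr => x _; case: first_meet.
Qed.

(** Markov's inequality for the squared component size: on the event, [card_component_sq_le] with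
    [L = m + 1] gives [(eps * N)^2 <= X c], and the first moments bound the mean of [X]. *)
Lemma kout_prob_has_component_le (eps : R) (m : nat) : 0 < eps -> (0 < n)%N ->
  kout_prob R 1 (@has_component_ge R n (eps * 2 ^+ n)) <=
    eps ^- 2 * (2 * (n.-1%:R / n%:R) ^+ m + m.+1%:R ^+ 2 / 2 ^+ n).
Proof.
move=> eps0 n0; rewrite kout_probE.
set N := 2 ^+ n; have N0 : 0 < N :> R by rewrite exprn_gt0.
have NE : #|vertex n|%:R = N :> R by rewrite card_vertex natrX.
have eN0 : 0 < eps * N by rewrite mulr_gt0.
set q := _ ^+ m.
pose long c := #|[set x | (m.+1 < order (target c) x)%N]|.
pose X c : R := N * (long c)%:R + N * (long c)%:R +
  \sum_(i < m.+1) \sum_(j < m.+1) #|[set xy | first_meet (target c) i j xy.1 xy.2]|%:R.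
apply: (@le_trans _ _ (kout_ex (fun c => (eps * N) ^- 2 * X c))).
  apply: kout_ex_le => c cL; rewrite [leRHS]mulrC ler_pdivlMr ?exprn_gt0 //.
  case big: (has_component_ge _ _).
    have /existsP[K /andP[/(card_component_sq_le m.+1 cL) KL big_K]] := big.
    rewrite mul1r; apply: (@le_trans _ _ (#|K|%:R ^+ 2)).
      by rewrite ler_pXn2r // nnegrE ?ler0n // ltW.
    move: KL; rewrite -(ler_nat R) !natrD natrX !natrM NE natr_sum.
    by under [X in _ <= _ + X]eq_bigr => i _ do rewrite natr_sum.
  rewrite mul0r /X; do !apply: addr_ge0; rewrite ?mulr_ge0 ?(ltW N0) //.
  by do 2 (apply: sumr_ge0 => ? _).
rewrite kout_exZ /X !kout_exD kout_exZ.
pose M (i j : nat) c : R := #|[set xy | first_meet (target c) i j xy.1 xy.2]|%:R.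
have -> : kout_ex (fun c => \sum_(i < m.+1) \sum_(j < m.+1) M i j c) =
    \sum_(i < m.+1) \sum_(j < m.+1) kout_ex (M i j).
  by rewrite kout_ex_sum; apply: eq_bigr => i _; apply: kout_ex_sum.
have := kout_ex_long_orbit m n0; rewrite -/N -/q => long_le.
have meet_le : \sum_(i < m.+1) \sum_(j < m.+1)
   kout_ex (fun c => #|[set xy | first_meet (target c) i j xy.1 xy.2]|%:R) <= m.+1%:R ^+ 2 * N.
  apply: (@le_trans _ _ (\sum_(i < m.+1) \sum_(j < m.+1) N)).
    by do 2 (apply: ler_sum => ? _); apply: kout_ex_meet.
  by rewrite !sumr_const !card_ord -mulrnA -[leLHS]mulr_natl natrM expr2.
apply: (@le_trans _ _ ((eps * N) ^- 2 * (N * (N * q) + N * (N * q) + m.+1%:R ^+ 2 * N))).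
  rewrite ler_pM2l ?invr_gt0 ?exprn_gt0 //.
  by apply: lerD meet_le; apply: lerD; rewrite ler_pM2l.
rewrite le_eqVlt; apply/orP; left; apply/eqP.
have e0 : eps != 0 by rewrite gt_eqF.
have : N != 0 by rewrite gt_eqF.
by move=> N_neq0; field; rewrite e0 N_neq0.
Qed.

End FirstMoment.

(** * Numerical estimates *)

(** The product of [((n-1)/n)^k] and [n + k] equals [n] at [k = 0] and does not increase with [k],
    since [(n-1)(n+k+1) <= n(n+k)]. *)
Lemma exp_pred_div_le (R : realFieldType) (n k : nat) : (0 < n)%N ->
  (n.-1%:R / n%:R) ^+ k <= n%:R / (n + k)%:R :> R.
Proof.
move=> n0; rewrite ler_pdivlMr ?ltr0n ?addn_gt0 ?n0 //.
elim: k => [|k IHk]; first by rewrite expr0 mul1r addn0.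
apply: le_trans IHk; rewrite exprSr -mulrA.
apply: ler_wpM2l; first by rewrite exprn_ge0 // divr_ge0.
rewrite mulrAC ler_pdivrMr ?ltr0n // -!natrM ler_nat.
by case: n n0 => // n _ /=; nia.
Qed.

(** The fifth power is what makes [(n^2 + 1)^2 / 2^n] of order [1/n]. With [q = n %/ 5] one has
    [n < 5 (q + 1) <= 5 * 2^q]; then take fifth powers. *)
Lemma exp5_le_2exp (n : nat) : (n ^ 5 <= 5 ^ 5 * 2 ^ n)%N.
Proof.
have le_n : (n <= 5 * 2 ^ (n %/ 5))%N.
  have := ltn_expl (n %/ 5) (isT : (1 < 2)%N); have := divn_eq n 5.
  by have := ltn_pmod n (isT : (0 < 5)%N); lia.
apply: leq_trans (_ : (5 * 2 ^ (n %/ 5)) ^ 5 <= _)%N; first by rewrite leq_exp2r.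
by rewrite expnMn leq_mul2l -expnM leq_exp2l ?leq_trunc_div ?orbT.
Qed.

(** The two terms are at most [2/n] and [4 * 5^5 / n]; the outer factor 2 pays for replacing [1/n]
    by [1/(n+1)], the form of [harmonic n]. *)
Lemma moment_bound_le (R : realFieldType) (n : nat) : (0 < n)%N ->
  2 * (n.-1%:R / n%:R) ^+ (n ^ 2) + (n ^ 2).+1%:R ^+ 2 / 2 ^+ n
    <= (2 * (2 + 4 * 5 ^ 5))%N%:R / n.+1%:R :> R.
Proof.
move=> n0.
have nR : 0 < n%:R :> R by rewrite ltr0n.
apply: (@le_trans _ _ ((2 + 4 * 5 ^ 5)%N%:R / n%:R)).
  rewrite [X in _ <= X / _]natrD [leRHS]mulrDl; apply: lerD.
  - apply: le_trans (ler_wpM2l _ (exp_pred_div_le R (n ^ 2) n0)) _ => //.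
    rewrite ler_wpM2l // ler_pdivrMr ?ltr0n ?addn_gt0 ?n0 // ler_pdivlMl //.
    by rewrite -natrM ler_nat; nia.
  - rewrite ler_pdivrMr ?exprn_gt0 // mulrAC ler_pdivlMr //.
    rewrite -!natrX -!natrM ler_nat.
    have le4 : ((n ^ 2).+1 ^ 2 <= 4 * n ^ 4)%N.
      rewrite (_ : 4 * n ^ 4 = (2 * n ^ 2) ^ 2)%N; last by rewrite expnMn -expnM.
      by rewrite leq_exp2r // mul2n -addnn -addn1 leq_add2l expn_gt0 n0.
    apply: leq_trans (leq_mul le4 (leqnn n)) _.
    by rewrite -mulnA -expnSr -mulnA leq_mul2l exp5_le_2exp.
move: (2 + _)%N => A.
rewrite ler_pdivrMr // mulrAC ler_pdivlMr ?ltr0n // -!natrM ler_nat.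
by rewrite (mulnC 2) -mulnA leq_mul2l; apply/orP; right; lia.
Qed.

(* Passage to the limit *)
From mathcomp Require Import all_classical all_reals all_analysis.
Import numFieldNormedType.Exports.
Local Open Scope classical_set_scope.
Local Open Scope ring_scope.

Theorem theorem1p1 (R : realType) (eps : R) (eps_gt0 : 0 < eps) :
  (fun n : nat => kout_prob R 1 (@has_component_ge R n (eps * 2 ^+ n)))
    @ \oo --> (0 : R).
Proof.
pose K : R := eps ^- 2 * (2 * (2 + 4 * 5 ^ 5))%N%:R.
apply: (@squeeze_cvgr _ _ _ R (fun=> 0) (fun n => K * harmonic n)).
- exists 1%N => // n /= n0; apply/andP; split.
    by apply: sumr_ge0 => c _; apply: prodr_ge0 => v _; rewrite /uniform_weight; case: ifP.
  (* The choice [m = n^2] makes long orbits rare, as [(1 - 1/n)^m <= 1/(n+1)], while [(m + 1)^2]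
     stays negligible against [2^n]. *)
  apply: le_trans (@kout_prob_has_component_le R n eps (n ^ 2) eps_gt0 n0) _.
  by rewrite /K -[leRHS]mulrA ler_wpM2l ?moment_bound_le // invr_ge0 exprn_ge0 // ltW.
- exact: cvg_cst.
- by rewrite -(mulr0 K); apply: cvgM; [exact: cvg_cst | exact: cvg_harmonic].
Qed.
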